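(* For a Random Walk in Random Environment on the Cayley graph $X(G,S)$ with environment law $\eta$ satisfying the standing assumption, we have for $\eta$-almost all $\omega$ $$\rho=\rho(P_\omega)=\sup_{\sigma}\rho(P_\sigma)=\sup_{\hat\sigma}\rho(P_{\hat\sigma}),$$ where $\rho$ denotes the $\eta$-almost surely constant value of $\rho(P_\omega)$, the first supremum is over all $\sigma=(\sigma_x)_{x\in X}$ with $\sigma_x\in\mathcal K$ for all $x\in X$, and the second supremum is over all $\hat\sigma=(\hat\sigma_x)_{x\in X}$ with $\hat\sigma_x\in\hat{\mathcal K}$ for all $x\in X$.
   Context: $G$ is a finitely generated group, $S$ a finite symmetric set of generators of $G$, and $X=G$ is the vertex set of the Cayley graph $X(G,S)$ ($x,y$ adjacent iff $x^{-1}y\in S$). $\mathcal M$ is the set of probability measures on $S$ and $Q$ is a probability distribution on $\mathcal M$, with support $\mathcal K$; $\hat{\mathcal K}$ is the convex hull of $\mathcal K$. The environment $\omega=(\omega_x)_{x\in X}$ consists of iid $\mathcal M$-valued random variables with law $Q$; its law is the product measure $\eta$. For any $\omega\in\mathcal M^X$, $P_\omega$ is the transition kernel on $X$ with $p_\omega(x,y)=\omega_x(x^{-1}y)$ if $x^{-1}y\in S$ and $0$ otherwise. Standing assumption: there are $\gamma>0$ and a minimal set of generators $S'\subseteq S$ (generating $G$ as a semigroup, so that the walks considered are irreducible) with $Q\{\omega:\omega(s)>\gamma\ \forall s\in S'\}=1$. Spectral radius: for an irreducible Markov chain $(X,P)$, $\rho(P):=\limsup_{n\to\infty}(p^{(n)}(x,x))^{1/n}\in(0,1]$,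 where $p^{(n)}(x,x)$ is the $n$-step return probability; it does not depend on $x$. *)

(* Defs.v *)
From HB Require Import structures.
From mathcomp Require Import all_boot all_order all_algebra finmap.
From mathcomp Require Import all_classical all_reals all_analysis.

Set Implicit Arguments.
Unset Strict Implicit.
Unset Printing Implicit Defensive.

Import Order.TTheory GRing.Theory Num.Theory.
Import numFieldNormedType.Exports.

Local Open Scope classical_set_scope.
Local Open Scope ring_scope.

Section Generation.
Context (G : groupType).

Definition symmetric_set (S : set G) : Prop := forall s, S s -> S s^-1%g.

Definition generates (S : set G) : Prop :=
  smallest [set H : set G | group_closed (mem H)] S = [set: G].

(* Nonempty products only: generation as a semigroup, not as a monoid. *)
Definition semigroup_generates (S : set G) : Prop :=
  smallest [set H : set G | mulg_closed (mem H)] S = [set: G].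

Definition minimal_semigroup_generators (S : set G) : Prop :=
  semigroup_generates S /\
  forall S0 : set G, S0 `<=` S -> semigroup_generates S0 -> S0 = S.

End Generation.

(* The library has no product sigma-algebra on [I -> U] for infinite [I]. *)
Section ProductSpace.
Context d (I : Type) (U : measurableType d).

Definition coord_preimages : set (set (I -> U)) :=
  \bigcup_i preimage_set_system [set: I -> U] (fun f => f i) measurable.

Definition prodMeasurableType := g_sigma_algebraType coord_preimages.

HB.instance Definition _ := Measurable.on prodMeasurableType.

End ProductSpace.

(* [eta] is determined by its values on finite-dimensional cylinders. *)
Definition is_product_measure (R : realType) d (I : choiceType)
    (U : measurableType d) (Q : probability U R)
    (eta : probability (prodMeasurableType I U) R) : Prop :=
  forall (A : {fset I}) (B : I -> set U), (forall i, measurable (B i)) ->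
    eta [set w : I -> U | forall i, i \in A -> B i (w i)] =
    (\prod_(i <- A) Q (B i))%E.

Section MarkovChain.
Context (R : realType) (X : choiceType).

(* [\sum_(z \in _)] ranges over the finite support of its summand; the kernels
   below have finitely many nonzero entries in each row. *)
Fixpoint nstep (P : X -> X -> R) (n : nat) (x y : X) : R :=
  if n is m.+1 then \sum_(z \in [set: X]) P x z * nstep P m z y
  else (x == y)%:R.

Definition spectral_radius (P : X -> X -> R) (x : X) : R :=
  limn_sup (fun n : nat => nstep P n x x `^ n%:R^-1).

End MarkovChain.

Section Environment.
Context (R : realType) (G : groupType) (S : {fset G}).

(* Measures on the finite set [S] are encoded as vectors in [S -> R], and laws
   on them as Borel probabilities on [S -> R] giving mass 1 to [prob_vectors].
   As [S] is finite, the product sigma-algebra is the Borel one. *)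
Definition stepType := prodMeasurableType S (measurableTypeR R).

HB.instance Definition _ := Measurable.on stepType.

Definition prob_vectors : set (S -> R) :=
  [set mu | (forall s, 0 <= mu s) /\ \sum_s mu s = 1].

Definition law_support (Q : probability stepType R) : set (S -> R) :=
  [set mu | forall V : set {ptws S -> R}, open V -> V mu -> (0 < Q V)%E].

Definition convex_hull (K : set (S -> R)) : set (S -> R) :=
  smallest (@convex_set R (S -> R^o)) K.

Definition envType := prodMeasurableType G stepType.

HB.instance Definition _ := Measurable.on envType.

Definition rwre_kernel (w : G -> S -> R) (x y : G) : R :=
  if insub (x^-1 * y)%g is Some s then w x s else 0.

End Environment.

(* Main.v *)
Require Import Defs.
From HB Require Import structures.
From mathcomp Require Import all_boot all_order all_algebra finmap.
From mathcomp Require Import all_classical all_reals all_analysis.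

Set Implicit Arguments.
Unset Strict Implicit.
Unset Printing Implicit Defensive.

Import Order.TTheory GRing.Theory Num.Theory.
Import numFieldNormedType.Exports.

Local Open Scope classical_set_scope.
Local Open Scope ring_scope.

(* For an irreducible walk, [l < rho(P)] forces the existence of a finitely
   supported [f >= 0], [f <> 0], with [P f >= l f] (truncate the Green function
   [\sum_n l^-n p^(n)(., x)] at a time [N] with [p^(N)(x, x) > l^N]); conversely
   any such [f] gives [l <= rho(P)]. The inequality [P f >= l f] is linear in
   each row of [P], so rows in the convex hull of [K] can be replaced by rows in
   [K]. It involves the finitely many rows over the support of [f] only and is
   stable under small perturbations and translations; on an infinite group the
   iid environment almost surely contains a translated approximate copy of any
   finite pattern with values in [K], by independence over disjoint translates.
   On a finite group every spectral radius is 1, with test function [f = 1]. *)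

(** * Walks and finitely supported test functions *)

Section LimSup.
Context (R : realType) (u : nat -> R) (M : R).
Hypothesis u_bound : forall n, `|u n| <= M.

Lemma norm_le_bounded_fun : bounded_fun u.
Proof.
exists M; split; first exact: num_real.
move=> x Mx n _; exact: le_trans (u_bound n) (ltW Mx).
Qed.

Let has_sup_sdrop n : has_sup (sdrop u n).
Proof.
split; first by exists (u n), n => //=.
by exists M => _ [m _ <-]; rewrite (le_trans (ler_norm _)).
Qed.

Lemma lt_limn_sup_ex l : l < limn_sup u ->
  forall N, exists2 n, (N <= n)%N & l < u n.
Proof.
rewrite (limn_supE norm_le_bounded_fun) => lu N.
have : l < sups u N.
  apply: lt_le_trans lu _; apply: ge_inf; last by exists N.
  exact/bounded_fun_has_lbound_sups/norm_le_bounded_fun.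
move=> /(sup_gt (has_sup_sdrop N).1)[_ [n /= Nn <-] ln].
by exists n.
Qed.

Lemma limn_sup_lt_ex l : limn_sup u < l ->
  exists N, forall n, (N <= n)%N -> u n < l.
Proof.
rewrite (limn_supE norm_le_bounded_fun).
move=> /(inf_lt (ex_intro _ _ (ex_intro2 _ _ 0 I erefl)))[_ [N _ <-] Nl].
exists N => n Nn; apply: le_lt_trans Nl.
by apply: (ub_le_sup (has_sup_sdrop N).2); exists n.
Qed.

End LimSup.

(** * Return probabilities, irreducibility and spectral radius *)

Section Walk.
Context (R : realType) (G : groupType) (S : {fset G}).
Implicit Types (w : G -> S -> R) (f : G -> R).

(** The operator [P] on functions, as a sum over the finite type [S] rather than a finitely
    supported sum over [G]. *)
Definition walk_op w f (x : G) : R := \sum_s w x s * f (x * val s)%g.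

Definition substochastic w :=
  (forall x s, 0 <= w x s) /\ (forall x, \sum_s w x s <= 1).

Definition irreducible w :=
  forall x y, exists n, 0 < nstep (rwre_kernel w) n x y.

Definition finite_support f := exists F : {fset G}, forall y, f y != 0 -> y \in F.

(** The row of [x] vanishes off the points [x * s], so the sum over [G] collapses to one over [S]:
    the first-step decomposition. *)
Lemma nstepS w n x y : nstep (rwre_kernel w) n.+1 x y =
  walk_op w (fun z => nstep (rwre_kernel w) n z y) x.
Proof.
rewrite /= /walk_op.
have rwreE s : rwre_kernel w x (x * val s)%g = w x s.
  by rewrite /rwre_kernel mulKg valK.
rewrite (fsbigE [seq (x * val s)%g | s <- index_enum S]) //=; first last.
- move=> z _ zx; rewrite /rwre_kernel; case: insubP => [s _ sE|_]; last by rewrite mul0r.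
  by case/mapP: zx; exists s; rewrite ?mem_index_enum// sE mulVKg.
- by rewrite map_inj_uniq ?index_enum_uniq// => s t /mulgI; exact: val_inj.
rewrite big_map; apply: eq_big => [s|s _]; first by rewrite in_setT.
by rewrite rwreE.
Qed.

Lemma walk_op_le w f g : (forall x s, 0 <= w x s) -> (forall x, f x <= g x) ->
  forall x, walk_op w f x <= walk_op w g x.
Proof. by move=> w0 fg x; apply: ler_sum => s _; apply: ler_wpM2l. Qed.

Lemma walk_opZ w c f x : walk_op w (fun y => c * f y) x = c * walk_op w f x.
Proof. by rewrite /walk_op mulr_sumr; apply: eq_bigr => s _; rewrite mulrCA. Qed.

Lemma walk_op_sum w (I : Type) (r : seq I) (f : I -> G -> R) x :
  walk_op w (fun y => \sum_(i <- r) f i y) x = \sum_(i <- r) walk_op w (f i) x.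
Proof.
by rewrite /walk_op exchange_big; apply: eq_bigr => s _; rewrite mulr_sumr.
Qed.

Lemma nstep_ge0 w n x y : (forall x s, 0 <= w x s) -> 0 <= nstep (rwre_kernel w) n x y.
Proof.
move=> w0; elim: n x => [|n IHn] x; first by rewrite /= ler0n.
by rewrite nstepS; apply: sumr_ge0 => s _; rewrite mulr_ge0.
Qed.

Lemma nstep_le1 w n x y : substochastic w -> nstep (rwre_kernel w) n x y <= 1.
Proof.
move=> [w0 w1]; elim: n x => [|n IHn] x; first by rewrite /= lern1 leq_b1.
rewrite nstepS (le_trans _ (w1 x))//; apply: ler_sum => s _.
by rewrite ler_piMr.
Qed.

(** Keeping a single term of the Chapman-Kolmogorov sum, the bound follows by induction on first
    steps. *)
Lemma nstepM_le w m n x y z : (forall x s, 0 <= w x s) ->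
  nstep (rwre_kernel w) m x y * nstep (rwre_kernel w) n y z <=
  nstep (rwre_kernel w) (m + n) x z.
Proof.
move=> w0; elim: m x => [|m IHm] x.
  rewrite add0n /=; case: eqVneq => [->|_]; first by rewrite mul1r.
  by rewrite mul0r nstep_ge0.
rewrite addSn !nstepS mulrC -walk_opZ; apply: walk_op_le => // u.
by rewrite mulrC.
Qed.

Lemma nstep_finite_support w n y : finite_support (fun x => nstep (rwre_kernel w) n x y).
Proof.
elim: n => [|n [F FP]].
  by exists [fset y]%fset => x /=; rewrite inE pnatr_eq0 eqb0 negbK.
exists [fset (z * (val s)^-1)%g | z in F, s in (finset.setT : {set S})]%fset => x.
rewrite nstepS; apply: contraR => xF; apply/eqP; apply: big1 => s _.
apply/eqP; rewrite mulf_eq0; apply/orP; right.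
apply: contraR xF => /FP zF; apply/imfset2P.
by exists (x * val s)%g => //; exists s; rewrite ?inE ?mulgK.
Qed.

Section Generating.
Context (w : G -> S -> R) (S' : {fset G}).
Hypotheses (w_ge0 : forall x s, 0 <= w x s).
Hypothesis S'_sub : [set` S'] `<=` [set` S].
Hypothesis S'_gen : semigroup_generates [set` S'].

Lemma elliptic_irreducible :
  (forall x s, val s \in S' -> 0 < w x s) -> irreducible w.
Proof.
move=> w_gt0 x y.
(* Quantifying over every starting point makes [H] closed under products, although the kernel need
   not be translation invariant. *)
pose H : set G := [set g | forall x, exists n, 0 < nstep (rwre_kernel w) n x (x * g)%g].
suff : H (x^-1 * y)%g by move=> /(_ x); rewrite mulVKg.
have : [set: G] (x^-1 * y)%g by [].
rewrite -S'_gen; apply; split.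
  move=> g h; rewrite !inE => Hg Hh {}x.
  have [m mP] := Hg x; have [n nP] := Hh (x * g)%g.
  exists (m + n)%N; rewrite mulgA.
  apply: lt_le_trans (nstepM_le _ _ _ (x * g)%g _ _) => //.
  exact: mulr_gt0.
move=> g gS' z; exists 1%N; rewrite nstepS.
have gS : g \in S by exact: S'_sub.
rewrite /walk_op (bigD1 [` gS]%fset)//=; apply: ltr_pwDl.
  by rewrite eqxx mulr1; exact: w_gt0.
by apply: sumr_ge0 => s _; rewrite mulr_ge0.
Qed.

End Generating.

Section SpectralRadius.
Context (w : G -> S -> R).
Hypothesis w_sub : substochastic w.

Let root_bound x n : `|nstep (rwre_kernel w) n x x `^ n%:R^-1| <= 1.
Proof.
rewrite ger0_norm ?powR_ge0//.
(* At [n = 0] the exponent is [0^-1 = 0] by convention, and the root is [1]. *)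
have [->|n0] := eqVneq n 0%N; first by rewrite invr0 powRr0.
rewrite [leRHS](_ : 1 = 1 `^ n%:R^-1); last by rewrite powR1.
rewrite ge0_ler_powR ?nnegrE ?invr_ge0//.
- by rewrite nstep_ge0//; case: w_sub.
- exact: nstep_le1.
Qed.

Lemma spectral_radius_le1 x : spectral_radius (rwre_kernel w) x <= 1.
Proof.
rewrite leNgt; apply/negP => /(lt_limn_sup_ex (root_bound x))/(_ 0)[n _].
by rewrite ltNge (le_trans (ler_norm _) (root_bound _ _)).
Qed.

Lemma spectral_radius_ge0 x : 0 <= spectral_radius (rwre_kernel w) x.
Proof.
rewrite leNgt; apply/negP => /(limn_sup_lt_ex (root_bound x))[N /(_ _ (leqnn N))].
by rewrite ltNge powR_ge0.
Qed.

(** Leaves only positive levels [l] to test, those for which the truncated Green function makes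
    sense. *)
Lemma spectral_radius_le x a : 0 <= a ->
  (forall l, 0 < l -> l < spectral_radius (rwre_kernel w) x -> l <= a) ->
  spectral_radius (rwre_kernel w) x <= a.
Proof.
move=> a0 la; rewrite leNgt; apply/negP => /[dup] aw /midf_lt[al lw].
by have := la _ (le_lt_trans a0 al) lw; rewrite leNgt al.
Qed.

Lemma lt_spectral_radius_ex x l : 0 <= l -> l < spectral_radius (rwre_kernel w) x ->
  exists n, l ^+ n.+1 < nstep (rwre_kernel w) n.+1 x x.
Proof.
(* An index at least [1] is requested: at [n = 0], raising to the power [n] does not undo the
   root. *)
move=> l0 /(lt_limn_sup_ex (root_bound x))/(_ 1%N)[[|n]// _ ln].
exists n; rewrite -[ltRHS]powRr1 ?nstep_ge0//; last by case: w_sub.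
have <- : n.+1%:R^-1 * n.+1%:R = 1 :> R by rewrite mulVf ?pnatr_eq0.
rewrite powRrM powR_mulrn ?powR_ge0//.
by rewrite ltrXn2r.
Qed.

Lemma spectral_radius_lt_ex x l : spectral_radius (rwre_kernel w) x < l ->
  exists N, forall n, (N <= n)%N -> nstep (rwre_kernel w) n x x <= l ^+ n.
Proof.
move=> /(limn_sup_lt_ex (root_bound x))[N Nl].
exists N.+1 => -[//|n] Nn; have ln := Nl _ (ltnW Nn).
rewrite -[leLHS]powRr1 ?nstep_ge0//; last by case: w_sub.
have <- : n.+1%:R^-1 * n.+1%:R = 1 :> R by rewrite mulVf ?pnatr_eq0.
rewrite powRrM powR_mulrn ?powR_ge0//.
by rewrite lerXn2r ?nnegrE ?powR_ge0 ?(ltW ln)// (le_trans (powR_ge0 _ _) (ltW ln)).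
Qed.

End SpectralRadius.

End Walk.

(** * Lower bounds on the spectral radius through test functions *)

Section TestFunctions.
Context (R : realType) (G : groupType) (S : {fset G}) (w : G -> S -> R).
Hypothesis w_sub : substochastic w.

Let w_ge0 : forall x s, 0 <= w x s. Proof. by case: w_sub. Qed.

(** [P] shifts the Green sum by one index, so [P f - l f] is [l] times the difference between the
    term of index [N + 1] and the indicator of [x]. At [x] the choice of [N] makes it nonnegative;
    elsewhere the indicator vanishes. *)
Lemma test_function_of_lt_spectral_radius x l : 0 < l ->
  l < spectral_radius (rwre_kernel w) x ->
  exists f, [/\ finite_support f, forall y, 0 <= f y, 0 < f x
              & forall y, l * f y <= walk_op w f y].
Proof.
move=> l0 /(lt_spectral_radius_ex w_sub (ltW l0))[N lN].
pose p n y := nstep (rwre_kernel w) n y x.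
have p0 n y : 0 <= p n y by exact: nstep_ge0.
pose f y := \sum_(0 <= n < N.+1) l^-1 ^+ n * p n y.
have term_ge0 n y : 0 <= l^-1 ^+ n * p n y.
  by rewrite mulr_ge0// exprn_ge0// invr_ge0 ltW.
exists f; split.
- have /choice[F FP] n : finite_support (p n) by exact: nstep_finite_support.
  exists (\bigcup_(n <- index_iota 0 N.+1) F n)%fset => y fy.
  apply: contraR fy => yF; apply/eqP; rewrite /f big_seq big1// => n nN.
  apply/eqP; rewrite mulf_eq0; apply/orP; right; apply: contraR yF => pny.
  by apply/bigfcupP; exists n; rewrite ?nN// FP.
- by move=> y; apply: sumr_ge0.
- rewrite /f big_nat_recl//= expr0 mul1r /p /= eqxx ltr_pwDl//.
  by apply: sumr_ge0 => n _; exact: term_ge0.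
move=> y.
have opf : walk_op w f y = \sum_(0 <= n < N.+1) l * (l^-1 ^+ n.+1 * p n.+1 y).
  rewrite walk_op_sum; apply: eq_bigr => n _.
  by rewrite walk_opZ -nstepS mulrA exprS mulrA divff ?gt_eqF// mul1r.
rewrite opf -mulr_sumr ler_pM2l//.
(* The same sum is peeled at its top on the left and at its bottom on the right. *)
have := erefl (\sum_(0 <= n < N.+2) l^-1 ^+ n * p n y).
rewrite {1}big_nat_recr// [in RHS]big_nat_recl//= -/(f y) expr0 mul1r => fE.
suff : (y == x)%:R <= l^-1 ^+ N.+1 * p N.+1 y.
  by rewrite -(lerD2l (f y)) fE [leLHS]addrC lerD2l.
case: eqVneq => [->|_]; last exact: term_ge0.
by rewrite exprVn mulrC ler_pdivlMr ?exprn_gt0// mul1r ltW.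
Qed.

(** Iterating [l f <= P f] bounds [l^n f(x0)] by the sum of [f(y) p^(n)(x0, y)] over the support.
    Paths of fixed lengths from [x] to [x0] and from [y] to [x] turn each term into a return
    probability at [x]. Were the radius below [l], this would be at most a constant times [q^n] with
    [q < l], which fails for large [n]. *)
Lemma test_function_le_spectral_radius f x0 l :
  irreducible w -> finite_support f -> (forall y, 0 <= f y) -> 0 < f x0 ->
  0 < l -> (forall y, l * f y <= walk_op w f y) ->
  forall x, l <= spectral_radius (rwre_kernel w) x.
Proof.
move=> w_irr [F FP] f0 fx0 l0 lf x; rewrite leNgt; apply/negP => rl.
(* [q] lies strictly between the radius and [l]; its second term shows [q > 0] at once. *)
pose q := Num.max ((spectral_radius (rwre_kernel w) x + l) / 2) (l / 2).
have q0 : 0 < q by rewrite lt_max [X in _ || X]divr_gt0// orbT.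
have ql : q < l by rewrite gt_max midf_lt//= ltr_pdivrMr// ltr_pMr// ltr1n.
have : spectral_radius (rwre_kernel w) x < q by rewrite lt_max midf_lt.
move=> /(spectral_radius_lt_ex w_sub)[N pq].
pose p := nstep (rwre_kernel w).
have lnf n z : l ^+ n * f z <= \sum_(y <- F) f y * p n z y.
  elim: n z => [|n IHn] z.
    rewrite expr0 mul1r; have [zF|zF] := boolP (z \in F).
      rewrite (big_fsetD1 z)//= /p /= eqxx mulr1 lerDl.
      by apply: sumr_ge0 => y _; rewrite mulr_ge0.
    have -> : f z = 0 by apply/eqP; apply: contraR zF => /FP.
    by apply: sumr_ge0 => y _; rewrite mulr_ge0// nstep_ge0.
  rewrite (eq_bigr (fun y => walk_op w (fun u => f y * p n u y) z)); last first.
    by move=> y _; rewrite /p nstepS walk_opZ.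
  rewrite -walk_op_sum exprSr -mulrA.
  apply: (@le_trans _ _ (l ^+ n * walk_op w f z)).
    by rewrite ler_wpM2l// exprn_ge0// ltW.
  by rewrite -walk_opZ; apply: walk_op_le.
have /choice[k kP] y := w_irr y x; have [j jP] := w_irr x x0.
(* The cost of closing the path: [j] steps from [x] to [x0], and [k y] steps from [y] back to
   [x]. *)
pose D y := f y * (q ^+ (j + k y) / (p j x x0 * p (k y) y x)).
have Dn n : (N <= n)%N -> l ^+ n * f x0 <= q ^+ n * \sum_(y <- F) D y.
  move=> Nn; apply: le_trans (lnf n x0) _; rewrite mulr_sumr.
  apply: ler_sum => y _; rewrite /D mulrCA ler_wpM2l// mulrA -exprD.
  rewrite ler_pdivlMr ?mulr_gt0// mulrCA mulrA.
  apply: (@le_trans _ _ (p (j + n + k y)%N x x)); last first.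
    by rewrite addnCA -addnA; apply: pq; rewrite addnCA (leq_trans Nn) ?leq_addr.
  apply: le_trans (nstepM_le _ _ _ y _ _) => //.
  by rewrite ler_wpM2r ?nstep_ge0 ?nstepM_le.
have D0 : 0 < 1 + \sum_(y <- F) D y.
  rewrite ltr_pwDl//; apply: sumr_ge0 => y _.
  by rewrite mulr_ge0// divr_ge0 ?exprn_ge0 ?mulr_ge0 ?nstep_ge0// ltW.
have /cvg_expr/cvgr_lt/(_ (f x0 / (1 + \sum_(y <- F) D y))) : `|q / l| < 1.
  by rewrite ger0_norm ?divr_ge0 ?(ltW q0) ?(ltW l0)// ltr_pdivrMr// mul1r.
rewrite divr_gt0// => /(_ isT) ev.
near \oo => n.
have Nn : (N <= n)%N by near: n; exact: nbhs_infty_ge.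
have : (q / l) ^+ n < f x0 / (1 + \sum_(y <- F) D y) by near: n.
rewrite expr_div_n ltr_pdivlMr// mulrAC ltr_pdivrMr ?exprn_gt0// mulrC.
rewrite [X in _ < X]mulrC ltNge => /negP; apply.
rewrite (le_trans (Dn n Nn))// [leRHS]mulrC ler_wpM2l ?exprn_ge0 ?(ltW q0)// lerDr.
Unshelve. all: by end_near. Qed.

End TestFunctions.

(** * Comparing environments *)

Section Comparison.
Context (R : realType) (G : groupType) (S S' : {fset G}) (gamma : R).
Hypotheses (gamma_gt0 : 0 < gamma) (S'_sub : [set` S'] `<=` [set` S]).
Hypothesis S'_gen : semigroup_generates [set` S'].
Implicit Types (mu : S -> R) (w : G -> S -> R).

(** The lower bound is non-strict so that it survives limits, and hence holds on the support of
    [Q]. *)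
Definition elliptic_vectors : set (S -> R) :=
  [set mu | prob_vectors mu /\ forall s, val s \in S' -> gamma <= mu s].

Lemma elliptic_substochastic w : (forall x, elliptic_vectors (w x)) -> substochastic w.
Proof.
move=> we; split=> [x s|x]; have [[w0 w1] _] := we x; first exact: w0.
by rewrite w1.
Qed.

Lemma elliptic_vectors_irreducible w : (forall x, elliptic_vectors (w x)) -> irreducible w.
Proof.
move=> we; apply: elliptic_irreducible S'_sub S'_gen _.
  by case: (elliptic_substochastic we).
by move=> x s sS'; apply: lt_le_trans gamma_gt0 _; case: (we x) => _; exact.
Qed.

(** A test function bounds the radius at every starting point, so one built at [x] serves at [y]. *)
Lemma spectral_radius_start w : (forall x, elliptic_vectors (w x)) ->
  forall x y, spectral_radius (rwre_kernel w) x = spectral_radius (rwre_kernel w) y.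
Proof.
move=> we; have w_sub := elliptic_substochastic we.
suff le x y : spectral_radius (rwre_kernel w) x <= spectral_radius (rwre_kernel w) y.
  by move=> x y; apply/le_anti; rewrite !le.
apply: spectral_radius_le => //; first exact: spectral_radius_ge0.
move=> l l0 /(test_function_of_lt_spectral_radius w_sub l0)[f [Ff f0 fx lf]].
exact: (test_function_le_spectral_radius w_sub
  (elliptic_vectors_irreducible we) Ff f0 fx l0 lf).
Qed.

Lemma convex_hull_min (K H : set (S -> R)) : @convex_set R (S -> R^o) H ->
  K `<=` H -> convex_hull K `<=` H.
Proof. by move=> cH KH mu; apply. Qed.

Lemma convE (mu nu : S -> R) (t : {i01 R}) s :
  (conv t (mu : convex_lmodType (S -> R^o)) nu : S -> R) s =
  t%:num * mu s + (1 - t%:num) * nu s.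
Proof. by []. Qed.

Lemma convex_elliptic_vectors : @convex_set R (S -> R^o) elliptic_vectors.
Proof.
move=> mu nu t; rewrite !inE => -[[mu0 mu1] mug] [[nu0 nu1] nug].
have t0 : 0 <= t%:num by [].
have t1 : 0 <= 1 - t%:num by rewrite subr_ge0.
split; first split.
- by move=> s; rewrite convE addr_ge0 ?mulr_ge0.
- under eq_bigr do rewrite convE.
  by rewrite big_split/= -!mulr_sumr mu1 nu1 !mulr1 subrKC.
- move=> s sS'; rewrite convE.
  have -> : gamma = t%:num * gamma + (1 - t%:num) * gamma by rewrite -mulrDl subrKC mul1r.
  by rewrite lerD ?ler_wpM2l ?mug ?nug.
Qed.

Lemma convex_halfspace (g : S -> R) c :
  @convex_set R (S -> R^o) [set mu : S -> R | \sum_s mu s * g s < c].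
Proof.
move=> mu nu t; rewrite !inE /= => muc nuc.
under eq_bigr do rewrite convE mulrDl -!mulrA.
rewrite big_split/= -!mulr_sumr.
have t1 : t%:num <= 1 by [].
have -> : c = t%:num * c + (1 - t%:num) * c by rewrite -mulrDl subrKC mul1r.
(* Strictness is taken from [mu], unless its weight [t] is zero. *)
have [->|tn0] := eqVneq t%:num 0; first by rewrite !mul0r !add0r subr0 !mul1r.
apply: ltr_leD; first by rewrite ltr_pM2l// lt0r tn0/=.
by rewrite ler_wpM2l ?subr_ge0// ltW.
Qed.

(* A vector of the convex hull cannot beat every element of [K] on a linear
   functional, so each row of the kernel can be moved into [K]. *)
Lemma convex_hull_test_function (K : set (S -> R)) w f l :
  (forall x, convex_hull K (w x)) -> (forall x, l * f x <= walk_op w f x) ->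
  exists2 w', forall x, K (w' x) & forall x, l * f x <= walk_op w' f x.
Proof.
move=> wK lf.
have /choice[w' w'P] x : exists mu, K mu /\ l * f x <= \sum_s mu s * f (x * val s)%g.
  apply: contrapT => /forallNP noK.
  have : [set mu : S -> R | \sum_s mu s * f (x * val s)%g < l * f x] (w x).
    move: (w x) (wK x); apply: convex_hull_min; first exact: convex_halfspace.
    move=> mu Kmu /=.
    by rewrite ltNge; apply/negP => lmu; exact: (noK mu).
  by rewrite /= ltNge lf.
by exists w' => x; have [] := w'P x.
Qed.

Section Support.
Context (K : set (S -> R)).
Hypothesis K_elliptic : K `<=` elliptic_vectors.

Lemma convex_hull_elliptic : convex_hull K `<=` elliptic_vectors.
Proof. exact: convex_hull_min convex_elliptic_vectors K_elliptic. Qed.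

Lemma has_sup_spectral_radius (H : set (S -> R)) x :
  H `<=` elliptic_vectors -> H !=set0 ->
  has_sup [set spectral_radius (rwre_kernel w) x | w in [set w | forall y, H (w y)]].
Proof.
move=> He [mu Hmu]; split; first by eexists; exists (fun=> mu).
exists 1 => _ [w Hw <-]; apply: spectral_radius_le1.
by apply: elliptic_substochastic => y; exact: He.
Qed.

(** Below the radius of a hull-valued environment there is a test function; it survives the
    replacement of rows by elements of [K], and then bounds the radius of a [K]-valued
    environment. *)
Lemma sup_spectral_radius_convex_hull x : K !=set0 ->
  sup [set spectral_radius (rwre_kernel w) x | w in [set w | forall y, K (w y)]] =
  sup [set spectral_radius (rwre_kernel w) x |
         w in [set w | forall y, convex_hull K (w y)]].
Proof.
move=> K0; have KH : K `<=` convex_hull K by exact: sub_smallest.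
have hK := has_sup_spectral_radius x K_elliptic K0.
have hH := has_sup_spectral_radius x convex_hull_elliptic (subset_nonempty KH K0).
apply/le_anti/andP; split.
  apply: le_sup hH; last by case: hK.
  by move=> _ [w Kw <-]; apply/downP; eexists; [exists w => // y; exact: KH|].
apply: sup_le_ub; first by case: hH.
move=> _ [w Hw <-].
have we y : elliptic_vectors (w y) by exact: convex_hull_elliptic.
have w_sub := elliptic_substochastic we.
apply: spectral_radius_le => //.
  have [_ [w' Kw' _]] := hK.1.
  apply: le_trans (ub_le_sup hK.2 (imageP _ Kw')); apply: spectral_radius_ge0.
  by apply: elliptic_substochastic => y; exact: K_elliptic.
move=> l l0 /(test_function_of_lt_spectral_radius w_sub l0)[f [Ff f0 fx lf]].
have [w' Kw' lf'] := convex_hull_test_function Hw lf.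
have we' y : elliptic_vectors (w' y) by exact: K_elliptic.
apply: le_trans (ub_le_sup hK.2 (imageP _ Kw')).
exact: (test_function_le_spectral_radius (elliptic_substochastic we')
  (elliptic_vectors_irreducible we') Ff f0 fx l0 lf').
Qed.

End Support.

Lemma spectral_radius_finite_group w x : finite_set [set: G] ->
  (forall y, elliptic_vectors (w y)) -> spectral_radius (rwre_kernel w) x = 1.
Proof.
move=> /finite_fsetP[F FE] we; have w_sub := elliptic_substochastic we.
apply/le_anti; rewrite spectral_radius_le1//=.
apply: (@test_function_le_spectral_radius _ _ _ _ w_sub (fun=> 1) x) => //.
- exact: elliptic_vectors_irreducible.
- by exists F => y _; have : [set: G] y by []; rewrite FE.
- move=> y; rewrite /walk_op mul1r; under eq_bigr do rewrite mulr1.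
  by case: (we y) => -[_ ->].
Qed.

(* Only the rows indexed by the support of [f] enter, up to a translation, and
   on it [f] is bounded away from 0: rows close enough to those of [w] keep
   [f] an approximate test function. *)
Lemma spectral_radius_near_pattern w f x0 l l' :
  (forall x, elliptic_vectors (w x)) ->
  finite_support f -> (forall y, 0 <= f y) -> 0 < f x0 -> 0 < l' -> l' < l ->
  (forall x, l * f x <= walk_op w f x) ->
  exists2 d : R, 0 < d & exists F : {fset G}, forall w' g,
    (forall x, elliptic_vectors (w' x)) ->
    (forall y, y \in F -> forall s, `|w' (g * y)%g s - w y s| < d) ->
    forall x, l' <= spectral_radius (rwre_kernel w') x.
Proof.
move=> we [F FP] f0 fx0 l'0 l'l lf.
pose M := \sum_(y <- F) f y.
have fM y : f y <= M.
  have [yF|yF] := boolP (y \in F); last first.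
    have -> : f y = 0 by apply/eqP; apply: contraR yF => /FP.
    by apply: sumr_ge0 => z _.
  by rewrite /M (big_fsetD1 y)//= lerDl; apply: sumr_ge0.
have M0 : 0 < M by exact: lt_le_trans fx0 (fM _).
have [m m0 mf] : exists2 m, 0 < m & forall y, f y != 0 -> m <= f y.
  exists (\big[Num.min/f x0]_(y : F | f (val y) != 0) f (val y)).
    by elim/big_rec : _ => // y a fy a0; rewrite lt_min a0 lt0r fy f0.
  by move=> y /[dup] fy /FP yF; apply: (bigmin_le_cond _ (j := [` yF]%fset)).
(* Moving the rows by less than [d] lowers [P f] by at most [#|S| d M <= (l - l') m], which is at
   most [(l - l') f y] on the support. The successor keeps the denominator nonzero. *)
pose d := (l - l') * m / (#|{: S}|.+1%:R * M).
have d0 : 0 < d by rewrite divr_gt0 ?mulr_gt0// subr_gt0.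
exists d => //; exists F => w' g we' w'w.
apply: (@test_function_le_spectral_radius _ _ _ _ (elliptic_substochastic we')
   (fun x => f (g^-1 * x)%g) (g * x0)%g) => //.
- exact: elliptic_vectors_irreducible.
- exists [fset (g * y)%g | y in F]%fset => y /FP yF.
  by apply/imfsetP; exists (g^-1 * y)%g => //=; rewrite mulVKg.
- by rewrite mulKg.
move=> x; have [fx|fx] := eqVneq (f (g^-1 * x)%g) 0.
  rewrite fx mulr0; apply: sumr_ge0 => s _; rewrite mulr_ge0//.
  by case: (we' x) => -[].
set y := (g^-1 * x)%g in fx *.
have xE : x = (g * y)%g by rewrite mulVKg.
have := lf y; rewrite -(lerD2r (- ((l - l') * m))).
have lm : l' * f y <= l * f y - (l - l') * m.
  by rewrite lerBrDr -lerBrDl -mulrBl ler_pM2l ?subr_gt0 ?mf.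
move=> /(le_trans lm)/le_trans; apply.
rewrite lerBlDr -lerBlDl /walk_op -sumrB.
apply: (@le_trans _ _ (\sum_(s : S) d * M)).
  apply: ler_sum => s _; rewrite mulgA -/y -mulrBl.
  apply: (@le_trans _ _ (d * f (y * val s)%g)); last by rewrite ler_pM2l.
  rewrite ler_wpM2r// (le_trans (ler_norm _))// distrC xE ltW// w'w//.
  exact: FP.
have -> : d * M = (l - l') * m / #|{: S}|.+1%:R.
  by rewrite /d invfM mulrA mulfVK ?gt_eqF.
rewrite sumr_const -[leLHS]mulr_natr mulrAC ler_pdivrMr//.
by rewrite ler_pM2l ?mulr_gt0 ?subr_gt0// ler_nat.
Qed.

End Comparison.

(** * Support of the one-site law *)

Section ProductMeasurable.
Context d (I : Type) (U : measurableType d).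

Lemma measurable_coord (i : I) : measurable_fun setT (fun f : prodMeasurableType I U => f i).
Proof.
move=> _ B mB; apply: sub_sigma_algebra; exists i => //.
by exists B.
Qed.

Lemma measurable_preimage_coord (i : I) (B : set U) : measurable B ->
  measurable [set f : prodMeasurableType I U | B (f i)].
Proof. by move=> mB; rewrite -[X in measurable X]setTI; exact: measurable_coord. Qed.

End ProductMeasurable.

Lemma ae_imp d (T : measurableType d) (R : realType)
    (mu : {measure set T -> \bar R}) (P P' : T -> Prop) :
  (forall x, P x -> P' x) -> {ae mu, forall x, P x} -> {ae mu, forall x, P' x}.
Proof. by move=> PP'; apply: filterS. Qed.

Lemma ae_imp2 d (T : measurableType d) (R : realType)
    (mu : {measure set T -> \bar R}) (P P' P'' : T -> Prop) :
  (forall x, P x -> P' x -> P'' x) -> {ae mu, forall x, P x} ->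
  {ae mu, forall x, P' x} -> {ae mu, forall x, P'' x}.
Proof. by move=> PP''; apply: filterS2. Qed.

(** The case of [nat] is transported along an injection; integers that code no index impose no
    condition. *)
Lemma ae_forall_countable d (T : measurableType d) (R : realType)
    (mu : {measure set T -> \bar R}) (J : Type) (P : J -> T -> Prop) :
  countable [set: J] -> (forall j, {ae mu, forall x, P j x}) ->
  {ae mu, forall x, forall j, P j x}.
Proof.
move=> /countable_injP[f finj] aeP.
have : {ae mu, forall x, forall n j, f j = n -> P j x}.
  apply: ae_foralln => n; have [[j jn]|nj] := pselect (exists j, f j = n).
    apply: filterS (aeP j) => x Pjx j' j'n.
    suff -> : j' = j by [].
    by apply: finj; rewrite ?inE// j'n.
  by apply: aeW => x j jn; case: nj; exists j.
by apply: filterS => x Px j; exact: Px.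
Qed.

(** * Boxes, the pointwise topology and the support of [Q] *)

Section Support.
Context (R : realType) (G : groupType) (S : {fset G}).

(** Open cubes link topology and measure: as [S] is finite they are open for pointwise convergence
    and measurable for the product sigma-algebra. *)
Definition box (mu : S -> R) (e : R) : set (S -> R) :=
  [set nu | forall s, `|nu s - mu s| < e].

Lemma measurable_forall_fin d (T : measurableType d) (J : finType) (B : J -> set T) :
  (forall j, measurable (B j)) -> measurable [set x | forall j, B j x].
Proof.
move=> mB; rewrite (_ : [set x | _] = \bigcap_j B j).
  by apply: fin_bigcap_measurable.
by apply/seteqP; split=> x Bx j => [_|]; exact: Bx.
Qed.

Lemma measurable_box mu e : measurable (box mu e : set (stepType R S)).
Proof.
apply: measurable_forall_fin => s.
apply: (@measurable_preimage_coord _ S (measurableTypeR R) s [set r | `|r - mu s| < e]).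
rewrite (_ : [set r | _] = `]mu s - e, mu s + e[%classic) //.
by apply/seteqP; split=> r /=; rewrite in_itv/= ltr_distl.
Qed.

Lemma open_box mu e : open (box mu e : set {ptws S -> R}).
Proof.
rewrite openE => nu nub.
apply: (@filter_forall {ptws S -> R} S _ (nbhs (nu : {ptws S -> R}))) => s.
apply: (@proj_continuous S (fun=> R) s nu [set r | `|r - mu s| < e]).
apply/nbhs_ballP; exists (e - `|nu s - mu s|) => /=; first by rewrite subr_gt0.
move=> r; rewrite -ball_normE/= ltrBrDl (distrC _ (mu s)) (distrC r).
by apply: le_lt_trans; exact: ler_distD.
Qed.

(** The filter generated by the boxes around [mu] converges to [mu] in each coordinate, hence
    pointwise, so it contains [V]. *)
Lemma open_ptws_box (V : set {ptws S -> R}) mu : open V -> V mu ->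
  exists2 e, 0 < e & box mu e `<=` V.
Proof.
move=> oV Vmu.
pose F := filter_from [set e : R | 0 < e] (box mu).
have FF : Filter F.
  apply: filter_from_filter; first by exists 1 => /=.
  move=> e e' /= e0 e'0; exists (Num.min e e'); first by rewrite /= lt_min e0.
  by move=> nu nub; split=> s; have := nub s; rewrite lt_min => /andP[].
have : {ptws, F --> mu}.
  apply/cvg_sup => s U [_ [[W oW <-] Wmu WU]].
  have /nbhs_ballP[e /= e0 eW] : nbhs (mu s) W by exact: open_nbhs_nbhs.
  exists e => // nu nub; apply/WU/eW.
  by rewrite -ball_normE/= distrC.
by move=> /(_ V)[|e e0 eV]; [exact: open_nbhs_nbhs|exists e].
Qed.

Lemma measurable_prob_vectors : measurable (@prob_vectors R G S : set (stepType R S)).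
Proof.
rewrite (_ : @prob_vectors R G S =
    [set mu | forall s, 0 <= mu s] `&` [set mu | \sum_s mu s = 1])//.
apply: measurableI.
  apply: measurable_forall_fin => s.
  apply: (@measurable_preimage_coord _ S (measurableTypeR R) s [set r | 0 <= r]).
  rewrite (_ : [set r | _] = `[0, +oo[%classic) //.
  by apply/seteqP; split => r /=; rewrite in_itv/= andbT.
have mf : measurable_fun setT (fun mu : stepType R S => \sum_(s : S) (mu s : R)).
  by apply: measurable_sum => s; exact: measurable_coord.
by have := mf measurableT [set 1] (measurable_set1 1); rewrite setTI.
Qed.

Lemma measurable_elliptic (S' : {fset G}) gamma :
  measurable ([set mu : S -> R | forall s : S, val s \in S' -> gamma < mu s]
    : set (stepType R S)).
Proof.
apply: (measurable_forall_fin
  (B := fun s => [set mu : stepType R S | val s \in S' -> gamma < mu s])) => s.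
have [sS'|sS'] := boolP (val s \in S'); last first.
  rewrite (_ : [set mu | _] = setT)//.
  by apply/seteqP; split=> // mu _ /=; rewrite (negPf sS').
rewrite (_ : [set mu | _] = [set mu : S -> R | gamma < mu s]).
  apply: (@measurable_preimage_coord _ S (measurableTypeR R) s [set r | gamma < r]).
  rewrite (_ : [set r | _] = `]gamma, +oo[%classic) //.
  by apply/seteqP; split => r /=; rewrite in_itv/= andbT.
by apply/seteqP; split=> mu /=; [exact|move=> + _].
Qed.

(** A base of the topology indexed by a countable type: rational centres, stored as finite
    functions, and radii [1 / (n + 1)]. *)
Definition rational_box (p : {ffun S -> rat} * nat) :=
  box (fun s => ratr (p.1 s)) p.2.+1%:R^-1.

Lemma rational_box_ex (V : set {ptws S -> R}) mu : open V -> V mu ->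
  exists p, rational_box p mu /\ rational_box p `<=` V.
Proof.
move=> oV Vmu; have [e e0 eV] := open_ptws_box oV Vmu.
(* Half of [e], because [mu] is not the centre of the rational box: two of its points are less than
   two radii apart. *)
have [n _ nP] := near_infty_natSinv_lt (PosNum (divr_gt0 e0 (ltr0Sn R 1))).
have {nP} : n.+1%:R^-1 < e / 2 by have := nP n (leqnn n).
set r := n.+1%:R^-1 => re.
have /choice[q qP] s : exists q : rat, `|mu s - ratr q| < r.
  have [|q] := @rat_in_itvoo R (mu s - r) (mu s + r).
    by rewrite ltrD2l -subr_gt0 opprK addr_gt0// invr_gt0.
  by rewrite in_itv/= -ltr_distl distrC => ?; exists q.
exists ([ffun s => q s], n); split=> [s /=|nu nub]; first by rewrite ffunE.
apply: eV => s; rewrite (splitr e).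
have := ltrD (lt_trans (nub s) re) (lt_trans (qP s) re).
by rewrite ffunE (distrC (mu s)); apply: le_lt_trans; exact: ler_distD.
Qed.

(** An open set is the countable union of the rational boxes inside it. *)
Lemma measurable_open_ptws (V : set {ptws S -> R}) : open V ->
  measurable (V : set (stepType R S)).
Proof.
move=> oV.
rewrite (_ : V = \bigcup_(p : {p | `[< rational_box p `<=` V >]}) rational_box (val p)).
  apply: countable_bigcupT_measurable; first exact: countableP.
  by move=> p; exact: measurable_box.
apply/seteqP; split=> [mu Vmu|mu [[p /asboolP pV] _ /= /pV //]].
have [p [pmu /asboolP pV]] := rational_box_ex oV Vmu.
by exists (exist _ p pV).
Qed.

Section Law.
Variable Q : probability (stepType R S) R.

(** A point off the support has a null open neighbourhood, hence lies in a null rational box; there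
    are countably many of these. *)
Lemma ae_law_support : {ae Q, forall mu, law_support Q mu}.
Proof.
have : {ae Q, forall mu, forall p : {p | `[< Q (rational_box p) = 0%E >]},
    ~ rational_box (val p) mu}.
  apply: ae_forall_countable; first exact: countableP.
  move=> [p /asboolP Qp] /=; exists (rational_box p).
  by split; [exact: measurable_box|exact: Qp|move=> mu /= /contrapT].
apply: ae_imp => mu mup V oV Vmu; rewrite lt0e measure_ge0 andbT.
apply/eqP => QV; have [p [pmu pV]] := rational_box_ex oV Vmu.
have /asboolP Qp : Q (rational_box p) = 0%E.
  apply: subset_measure0 QV => //; first exact: measurable_box.
  exact: measurable_open_ptws.
exact: (mup (exist _ p Qp)).
Qed.

Lemma law_support_box_gt0 mu e : 0 < e -> law_support Q mu -> (0 < Q (box mu e))%E.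
Proof.
by move=> e0; apply; [exact: open_box|move=> s /=; rewrite subrr normr0].
Qed.

(** Exhibits support points as limits of points of any set of full measure. *)
Lemma law_support_box_meets mu e (E : set (stepType R S)) : 0 < e -> measurable E ->
  Q E = 1%E -> law_support Q mu -> exists2 nu, E nu & box mu e nu.
Proof.
move=> e0 mE QE /(law_support_box_gt0 e0) Qb; apply: contrapT => noE.
suff : Q (box mu e) = 0%E by move=> Q0; rewrite Q0 ltxx in Qb.
apply: (@subset_measure0 _ _ _ _ _ (~` E)).
- exact: measurable_box.
- exact: measurableC.
- by move=> nu nub Enu; apply: noE; exists nu.
- have := probability_setC Q mE; rewrite QE subee//; exact.
Qed.

(** Support points are limits both of probability vectors and of vectors above [gamma] on [S'];
    these conditions pass to the limit, the strict one becoming non-strict. *)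
Lemma law_support_elliptic (S' : {fset G}) (gamma : R) :
  Q (@prob_vectors R G S) = 1%E ->
  Q [set mu : S -> R | forall s : S, val s \in S' -> gamma < mu s] = 1%E ->
  law_support Q `<=` elliptic_vectors S' gamma.
Proof.
move=> Qprob Qell mu Kmu.
have near_prob e (e0 : 0 < e) := law_support_box_meets e0 measurable_prob_vectors Qprob Kmu.
have near_ell e (e0 : 0 < e) :=
  law_support_box_meets e0 (@measurable_elliptic S' gamma) Qell Kmu.
split; first split.
- move=> s; apply/ler_addgt0Pr => e e0; have [nu [nu0 _] nub] := near_prob e e0.
  have := nub s; rewrite ltr_distl => /andP[_ /ltW]; apply: le_trans; exact: nu0.
- apply/eqP; rewrite -subr_eq0 -normr_le0; apply/ler_addgt0Pr => e e0; rewrite add0r.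
  (* The [#|S|] coordinate errors then add up to at most [e]. *)
  pose d := e / #|{: S}|.+1%:R.
  have d0 : 0 < d by rewrite divr_gt0.
  have [nu [_ nu1] nub] := near_prob d d0.
  rewrite -nu1 -sumrB (le_trans (ler_norm_sum _ _ _))//.
  apply: (@le_trans _ _ (\sum_(s : S) d)).
    by apply: ler_sum => s _; rewrite distrC ltW.
  rewrite sumr_const -[leLHS]mulr_natr mulrAC ler_pdivrMr//.
  by rewrite ler_pM2l// ler_nat.
- move=> s sS'; apply/ler_addgt0Pr => e e0.
  have [nu nug nub] := near_ell e e0.
  have := nub s; rewrite ltr_distl => /andP[_ /ltW]; apply: le_trans.
  by rewrite ltW// nug.
Qed.

End Law.

End Support.

(** * Finite patterns in product measures *)

Section Independence.
Context (R : realType) d (I : choiceType) (U : measurableType d).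
Variables (Q : probability U R) (eta : probability (prodMeasurableType I U) R).
Hypothesis eta_product : is_product_measure Q eta.

Definition cylinder (A : {fset I}) (B : I -> set U) : set (prodMeasurableType I U) :=
  [set w | forall i, i \in A -> B i (w i)].

Lemma measurable_cylinder A B : (forall i, measurable (B i)) -> measurable (cylinder A B).
Proof.
move=> mB; rewrite (_ : cylinder A B = \bigcap_(i in [set` A]) [set w | B i (w i)])//.
apply: fin_bigcap_measurable => // i _; exact: measurable_preimage_coord.
Qed.

Definition avoid (J : Type) (A : J -> {fset I}) (B : J -> I -> set U) (l : seq J) :
    set (prodMeasurableType I U) :=
  \big[setI/setT]_(j <- l) ~` cylinder (A j) (B j).

Lemma measurable_avoid J (A : J -> {fset I}) B l :
  (forall j i, measurable (B j i)) -> measurable (avoid A B l).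
Proof.
move=> mB; apply: bigsetI_measurable => j _.
by apply: measurableC; exact: measurable_cylinder.
Qed.

(** Independence over disjoint index sets: the intersection is again a cylinder, with [B] on [A] and
    [B'] elsewhere, and its product formula splits. Keeping the merged cylinder in the conclusion
    allows iteration. *)
Lemma cylinderI_disjoint (A A' : {fset I}) B B' : [disjoint A & A']%fset ->
  (forall i, measurable (B i)) -> (forall i, measurable (B' i)) ->
  exists2 B'' : I -> set U, forall i, measurable (B'' i) &
    cylinder A B `&` cylinder A' B' = cylinder (A `|` A')%fset B'' /\
    eta (cylinder (A `|` A')%fset B'') = (eta (cylinder A B) * eta (cylinder A' B'))%E.
Proof.
move=> AA' mB mB'; exists (fun i => if i \in A then B i else B' i).
  by move=> i; case: ifP.
have A'A i : i \in A' -> i \in A = false.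
  by move=> iA'; apply/negbTE/(fdisjointP_sym AA').
split.
  apply/seteqP; split=> w /=.
    move=> [AB AB'] i; rewrite inE; case: ifPn => [iA _|_ /= ]; first exact: AB.
    exact: AB'.
  move=> AB; split=> i iA; have := AB i; rewrite inE iA ?orbT.
    by apply.
  by rewrite A'A//; apply.
rewrite !eta_product//; last by move=> i; case: ifP.
rewrite (perm_big (enum_fset A ++ enum_fset A')) /=; last first.
  apply: uniq_perm => //.
    rewrite cat_uniq !fset_uniq /= andbT; apply/hasPn => i iA'.
    exact: negbT (A'A i iA').
  by move=> i; rewrite inE mem_cat.
rewrite big_cat /=; congr (_ * _)%E; rewrite !big_seq; apply: eq_bigr => i iA.
  by rewrite iA.
by rewrite A'A.
Qed.

(** The extra cylinder over [A0] makes the induction work: avoiding one more cylinder [j] is a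
    difference of two instances for the shorter list, with index sets [A0] and [A0] joined with
    [A j]. *)
Lemma measure_cylinder_avoid (J : eqType) (A : J -> {fset I}) (B : J -> I -> set U)
    (l : seq J) (A0 : {fset I}) (B0 : I -> set U) :
  (forall j i, measurable (B j i)) -> (forall i, measurable (B0 i)) ->
  (forall j, j \in l -> [disjoint A0 & A j]%fset) ->
  pairwise (fun j k => [disjoint A j & A k]%fset) l ->
  eta (cylinder A0 B0 `&` avoid A B l) =
  (eta (cylinder A0 B0) * \prod_(j <- l) (1 - eta (cylinder (A j) (B j))))%E.
Proof.
move=> mB; elim: l A0 B0 => [|j l IHl] A0 B0 mB0.
  by rewrite /avoid !big_nil setIT mule1.
move=> A0l /= /andP[/allP jl lP].
have A0j : [disjoint A0 & A j]%fset by apply: A0l; rewrite inE eqxx.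
have [B1 mB1 [B1E etaB1]] := cylinderI_disjoint A0j mB0 (mB j).
have mE := measurable_cylinder A0 mB0; have mC := measurable_cylinder (A j) (mB j).
have mL := measurable_avoid A l mB.
have fin (D : set (prodMeasurableType I U)) : measurable D -> eta D \is a fin_num.
  by move=> mD; exact: fin_num_measure.
rewrite (_ : _ `&` _ = (cylinder A0 B0 `&` avoid A B l) `\` cylinder (A j) (B j)); last first.
  by rewrite /avoid big_cons setIA -setIA setICA setIC.
transitivity (eta (cylinder A0 B0 `&` avoid A B l) -
    eta (cylinder (A0 `|` A j)%fset B1 `&` avoid A B l))%E.
  rewrite measureD//; last 2 first.
  - exact: measurableI.
  - by rewrite ltey_eq fin//; exact: measurableI.
  by rewrite setIAC B1E.
rewrite (IHl A0 B0)//; last by move=> k kl; rewrite A0l// inE kl orbT.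
rewrite (IHl (A0 `|` A j)%fset B1)//; last first.
  by move=> k kl; rewrite fdisjointUX A0l ?inE ?kl ?orbT//=; exact: jl.
rewrite etaB1 big_cons.
set P := (\prod_(k <- l) _)%E.
have Pfin : P \is a fin_num.
  rewrite /P; elim/big_ind : _ => // [x y|k _]; first exact: fin_numM.
  by rewrite fin_numB/= fin//; exact: measurable_cylinder.
(* All the quantities being finite, the identity reduces to one between real numbers. *)
clearbody P; move: (fin _ mE) (fin _ mC) Pfin.
move: (eta (cylinder A0 B0)) (eta (cylinder (A j) (B j))) P => [a||]// [c||]// [q||]// _ _ _.
apply: (congr1 EFin (_ : a * q - a * c * q = a * ((1 - c) * q))).
by rewrite mulrBl mul1r mulrBr mulrA.
Qed.

End Independence.

(** * Occurrence of finite patterns in iid environments on a group *)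

Section Patterns.
Context (G : groupType).

(** Every element is the value of a finite word over [S]. *)
Lemma semigroup_generates_countable (S : {fset G}) :
  semigroup_generates [set` S] -> countable [set: G].
Proof.
pose word (l : seq S) : G := foldr (fun s g => (val s * g)%g) 1%g l.
move=> Sgen; have -> : [set: G] = range word.
  apply/seteqP; split=> // g; rewrite -Sgen; apply; split.
    move=> u v; rewrite !inE => -[k _ <-] [l _ <-]; exists (k ++ l) => //.
    by elim: k => [|s k IHk] /=; rewrite ?mul1g// IHk mulgA.
  by move=> s sS; exists [:: [` sS]%fset] => //=; rewrite mulg1.
exact: sub_countable (card_image_le _ _) (countableP _).
Qed.

Definition translate (F : {fset G}) (g : G) : {fset G} := [fset (g * y)%g | y in F]%fset.

(** Greedy choice: the translates of [F] by [g] and [h] meet only if [g = h y' y^-1] with [y, y'] in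
    [F], which excludes finitely many [g]. *)
Lemma disjoint_translates (F : {fset G}) n : infinite_set [set: G] ->
  exists l : seq G, size l = n /\
    pairwise (fun g h => [disjoint translate F g & translate F h]%fset) l.
Proof.
move=> infG; elim: n => [|n [l [ln lF]]]; first by exists [::].
pose bad := [seq (h * z)%g | h <- l, z <- [seq (y' * y^-1)%g | y' <- F, y <- F]].
have [g gbad] : exists g, g \notin bad.
  apply: contrapT => /forallNP allbad; apply: infG.
  apply: sub_finite_set (finite_seq bad) => g _ /=.
  by apply: contrapT => /negP; exact: allbad.
exists (g :: l); split; rewrite /= ?ln// lF andbT; apply/allP => h hl.
apply/fdisjointP => _ /imfsetP[y /= yF ->]; apply/imfsetP => -[y' /= y'F gyE].
move/negP: gbad; apply; have -> : g = (h * (y' * y^-1))%g by rewrite mulgA -gyE mulgK.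
by apply: allpairs_f => //; exact: allpairs_f.
Qed.

Context (R : realType) d (U : measurableType d) (Q : probability U R).
Variable eta : probability (prodMeasurableType G U) R.
Hypothesis eta_product : is_product_measure Q eta.

(** The iid law is invariant under left translations; the value does not depend on [g]. *)
Lemma measure_translated_cylinder (F : {fset G}) (B : G -> set U) g :
  (forall y, measurable (B y)) ->
  eta (cylinder (translate F g) (fun i => B (g^-1 * i)%g)) = (\prod_(y <- F) Q (B y))%E.
Proof.
move=> mB; rewrite eta_product// big_imfset/=.
  by apply: eq_bigr => y _; rewrite mulKg.
by move=> x y _ _; exact: mulgI.
Qed.

(** Each translate carries the pattern with the same probability [p > 0], so [n] disjoint ones all
    miss it with probability [(1 - p)^n], which tends to [0]. *)
Lemma ae_pattern_occurs (F : {fset G}) (B : G -> set U) : infinite_set [set: G] ->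
  (forall y, measurable (B y)) -> (forall y, y \in F -> (0 < Q (B y))%E) ->
  {ae eta, forall w, exists g, forall y, y \in F -> B y (w (g * y)%g)}.
Proof.
move=> infG mB QB.
pose Bt g i := B (g^-1 * i)%g.
pose p := \prod_(y <- F) fine (Q (B y)).
have fQ D : measurable D -> Q D = (fine (Q D))%:E.
  by move=> mD; rewrite fineK// fin_num_measure.
have pE g : eta (cylinder (translate F g) (Bt g)) = p%:E.
  rewrite measure_translated_cylinder// /p -prodEFin.
  by apply: eq_bigr => y _; rewrite -fQ.
have p0 : 0 < p.
  rewrite /p big_seq; apply: prodr_gt0 => y yF.
  by rewrite -lte_fin -fQ ?QB.
have p1 : p <= 1.
  rewrite -lee_fin -(pE 1%g) probability_le1//.
  apply: measurable_cylinder => i; exact: mB.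
have /choice[l lP] n := disjoint_translates F n infG.
have mN n : measurable (avoid (translate F) Bt (l n)) 
  by apply: measurable_avoid => g i; exact: mB.
have etaN n : eta (avoid (translate F) Bt (l n)) = ((1 - p) ^+ n)%:E.
  (* With the empty index set the extra cylinder is the whole space. *)
  have := measure_cylinder_avoid eta_product (A := translate F) (B := Bt) (l := l n)
    (A0 := fset0) (B0 := fun=> setT).
  rewrite (_ : cylinder fset0 _ = setT) ?setTI ?probability_setT ?mul1e; last first.
    by apply/seteqP; split=> // w _ i; rewrite inE.
  move=> -> //; last by have [] := lP n.
    under eq_bigr do rewrite pE -EFinB.
    by rewrite prodEFin big_const_seq count_predT iter_mulr_1; have [->] := lP n.
  - by move=> g i; exact: mB.
  - by move=> g _; exact: fdisjoint0X.
exists (\bigcap_n avoid (translate F) Bt (l n)); split.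
- exact: bigcap_measurable.
- have eta0 : (0 <= eta (\bigcap_n avoid (translate F) Bt (l n)))%E by [].
  apply/eqP; rewrite eq_le eta0 andbT; apply/lee_addgt0Pr => e e0; rewrite add0e.
  (* The lists [l n] need not be nested: the intersection lies in each single event, and one of
     small probability is enough. *)
  have /cvg_expr/cvgr_lt/(_ e e0) [n _ nP] : `|1 - p| < 1.
    by rewrite ger0_norm ?subr_ge0// ltrBlDr ltrDl.
  apply: (@le_trans _ _ (eta (avoid (translate F) Bt (l n)))).
    by apply: le_measure; rewrite ?inE//; [exact: bigcap_measurable|move=> w; apply].
  by rewrite etaN lee_fin ltW// nP/=.
- move=> w /= now n _; rewrite /avoid.
  elim: (l n) => [|g k IHk]; first by rewrite big_nil.
  rewrite big_cons; split=> // wg; apply: now; exists g => y yF.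
  have := wg (g * y)%g; rewrite /Bt mulKg; apply.
  by apply/imfsetP; exists y.
Qed.

End Patterns.

(** * Almost sure spectral radius *)

Section AlmostSure.
Context (R : realType) (G : groupType) (S S' : {fset G}) (gamma : R).
Hypotheses (gamma_gt0 : 0 < gamma) (S'_sub : [set` S'] `<=` [set` S]).
Hypothesis S'_gen : semigroup_generates [set` S'].
Variables (Q : probability (stepType R S) R) (eta : probability (envType R S) R).
Hypothesis eta_product : is_product_measure Q eta.
Hypothesis support_elliptic : law_support Q `<=` elliptic_vectors S' gamma.

Local Notation K := (law_support Q).
Local Notation radii x :=
  [set spectral_radius (rwre_kernel w) x | w in [set w | forall y, K (w y)]].

(** With an empty support the whole space would be [Q]-null. *)
Lemma law_support_nonempty : K !=set0.
Proof.
have [N [mN QN KN]] := ae_law_support Q.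
apply: contrapT => /nonemptyPn K0.
have NT : N = setT by apply/seteqP; split=> // mu _; apply: KN; rewrite /= K0.
by have := probability_setT Q; rewrite -NT QN => /esym/eqP; rewrite eqe oner_eq0.
Qed.

(** One-point cylinders show that each site has law [Q], and [G] is countable. *)
Lemma ae_environment_in_support : {ae eta, forall w, forall y, K (w y)}.
Proof.
apply: ae_forall_countable; first exact: semigroup_generates_countable S'_gen.
move=> y; have [N [mN QN KN]] := ae_law_support Q.
exists [set w | N (w y)]; split; first exact: measurable_preimage_coord.
  have := eta_product [fset y]%fset (fun=> mN); rewrite big_seq_fset1 QN => <-.
  congr (eta _); apply/seteqP; split=> w /= Nw => [i|].
    by rewrite inE => /eqP->.
  by apply: Nw; rewrite inE.
by move=> w /= nK; apply: KN.
Qed.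

(** Some [K]-valued [w0] has radius above [l]. The boxes around its rows have positive mass, so
    almost surely a translated copy of its finite pattern occurs. *)
Lemma ae_spectral_radius_ge x l : infinite_set [set: G] -> 0 < l -> l < sup (radii x) ->
  {ae eta, forall w, (forall y, K (w y)) -> l <= spectral_radius (rwre_kernel w) x}.
Proof.
move=> infG l0 lsup; have K0 := law_support_nonempty.
have [_ [w0 Kw0 <-] lw0] := sup_gt (has_sup_spectral_radius x support_elliptic K0).1 lsup.
(* The test function is built at the higher level [l']; the gap down to [l] absorbs the perturbation
   of the rows. *)
have [ll' l'w0] := midf_lt lw0; set l' := (l + _) / 2 in ll' l'w0.
have ell (w : G -> S -> R) : (forall y, K (w y)) ->
    forall y, elliptic_vectors S' gamma (w y).
  by move=> Kw y; exact: support_elliptic.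
have w0e := ell w0 Kw0.
have [f [Ff f0 fx lf]] := test_function_of_lt_spectral_radius
  (elliptic_substochastic w0e) (lt_trans l0 ll') l'w0.
have [d d0 [F FP]] :=
  spectral_radius_near_pattern gamma_gt0 S'_sub S'_gen w0e Ff f0 fx l0 ll' lf.
have := ae_pattern_occurs (F := F) (B := fun y => box (w0 y) d) eta_product infG
  (fun y => measurable_box (w0 y) d) (fun y _ => law_support_box_gt0 d0 (Kw0 y)).
apply: ae_imp => w [g gP] Kw.
by apply: (FP w g) => //; exact: ell.
Qed.

(** The upper bound holds because the environment is itself almost surely [K]-valued. For the lower
    bound on an infinite group, the supremum is approached along the countably many levels
    [sup - 1 / (k + 1)], so that the exceptional null sets can be united. *)
Lemma ae_spectral_radius x :
  {ae eta, forall w, spectral_radius (rwre_kernel w) x = sup (radii x)}.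
Proof.
have K0 := law_support_nonempty.
have hK := has_sup_spectral_radius x support_elliptic K0.
have ell (w : G -> S -> R) : (forall y, K (w y)) ->
    forall y, elliptic_vectors S' gamma (w y).
  by move=> Kw y; exact: support_elliptic.
have [finG|infG] := pselect (finite_set [set: G]).
  apply: ae_imp ae_environment_in_support => w Kw.
  have radius1 (w' : G -> S -> R) : (forall y, K (w' y)) ->
      spectral_radius (rwre_kernel w') x = 1.
    move=> Kw'; apply: (spectral_radius_finite_group gamma_gt0 S'_sub S'_gen) => //.
    exact: ell.
  rewrite (_ : radii x = [set 1]) ?sup1 ?radius1//.
  apply/seteqP; split=> [_ [w' Kw' <-]|_ ->] /=; first exact: radius1.
  by exists w => //; exact: radius1.
have aek : {ae eta, forall w, forall k : nat, (forall y, K (w y)) ->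
    sup (radii x) - k.+1%:R^-1 <= spectral_radius (rwre_kernel w) x}.
  apply: ae_foralln => k; set l := sup _ - _.
  (* Nonpositive levels are trivial; the pattern argument takes positive ones. *)
  have [l0|l0] := leP l 0.
    apply: aeW => w Kw; apply: le_trans l0 _.
    exact: spectral_radius_ge0 (elliptic_substochastic (ell w Kw)) x.
  by apply: ae_spectral_radius_ge => //; rewrite ltrBlDr ltrDl invr_gt0.
apply: (ae_imp2 _ aek ae_environment_in_support) => w kP Kw.
apply/le_anti/andP; split.
  by apply: (ub_le_sup hK.2); exists w.
rewrite leNgt -subr_gt0; apply/negP => e0.
have [n _ /(_ n (leqnn n)) /=] := near_infty_natSinv_lt (PosNum e0).
by have := kP n Kw; rewrite lerBlDr -lerBlDl leNgt => /negPf ->.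
Qed.

End AlmostSure.

Theorem theorem3p4 (R : realType) (G : groupType) (S : {fset G})
    (S_symmetric : symmetric_set [set` S])
    (S_generates : generates [set` S])
    (Q : probability (stepType R S) R)
    (Q_prob : Q (prob_vectors (R := R) (S := S)) = 1%E)
    (gamma : R) (gamma_gt0 : 0 < gamma)
    (S' : {fset G}) (S'_sub : [set` S'] `<=` [set` S])
    (S'_minimal : minimal_semigroup_generators [set` S'])
    (Q_elliptic :
      Q [set mu : S -> R | forall s : S, val s \in S' -> gamma < mu s] = 1%E)
    (eta : probability (envType R S) R)
    (eta_product : is_product_measure Q eta) :
  exists rho : R, forall x : G,
    [/\ {ae eta, forall w : G -> S -> R,
           spectral_radius (rwre_kernel w) x = rho},
        rho = sup [set spectral_radius (rwre_kernel sigma) x | sigma in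
                     [set sigma | forall y, law_support Q (sigma y)]]
      & rho = sup [set spectral_radius (rwre_kernel sigma) x | sigma in
                     [set sigma | forall y,
                        convex_hull (law_support Q) (sigma y)]] ].
Proof.
have S'_gen := S'_minimal.1.
pose K := law_support Q; have Kell := law_support_elliptic Q_prob Q_elliptic.
have He := convex_hull_elliptic Kell.
have radii_start (H : set (S -> R)) x : H `<=` elliptic_vectors S' gamma ->
    [set spectral_radius (rwre_kernel w) x | w in [set w | forall y, H (w y)]] =
    [set spectral_radius (rwre_kernel w) 1%g | w in [set w | forall y, H (w y)]].
  move=> Hell; apply: eq_imagel => w Hw.
  by apply: (spectral_radius_start gamma_gt0 S'_sub S'_gen) => y; exact: Hell.
(* The radii do not depend on the starting point, so the value at the identity serves every [x]. *)
exists (sup [set spectral_radius (rwre_kernel w) 1%g | w in [set w | forall y, K (w y)]]).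
move=> x; split.
- rewrite -(radii_start K x Kell).
  exact: (ae_spectral_radius gamma_gt0 S'_sub S'_gen eta_product Kell).
- by rewrite -(radii_start K x Kell).
- rewrite -(radii_start K x Kell).
  apply: (sup_spectral_radius_convex_hull gamma_gt0 S'_sub S'_gen Kell).
  exact: law_support_nonempty.
Qed.
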